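(* Let $L$ be a finite BL-algebra which is not an MV-algebra. Then there is no commutative unitary ring $R$ such that $Id(R)=L$, i.e. such that the residuated lattice $Id(R)$ of ideals of $R$ is isomorphic to $L$.
   Context: A (commutative) residuated lattice is an algebra $(L,\wedge,\vee,\odot,\rightarrow,0,1)$ such that $(L,\wedge,\vee,0,1)$ is a bounded lattice with order $\leq$, $(L,\odot,1)$ is a commutative ordered monoid, and $z\leq x\rightarrow y$ iff $x\odot z\leq y$ for all $x,y,z\in L$. Put $x^{\ast}=x\rightarrow 0$. A BL-algebra is a residuated lattice satisfying $(x\rightarrow y)\vee(y\rightarrow x)=1$ and $x\odot(x\rightarrow y)=x\wedge y$ for all $x,y$. A BL-algebra is an MV-algebra when $x^{\ast\ast}=x$ for all $x$. For a commutative unitary ring $R$, $Id(R)$ denotes the set of all ideals of $R$, which is a residuated lattice $(Id(R),\cap,+,\otimes,\rightarrow,\{0\},R)$ ordered by inclusion, where $I\otimes J$ is the product of ideals (finite sums of products $ij$, $i\in I$, $j\in J$) and $I\rightarrow J=(J:I)=\{x\in R: xI\subseteq J\}$. *)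

(* Defs.v *)
From HB Require Import structures.
From mathcomp Require Import all_boot all_order all_algebra.
From mathcomp Require Import boolp classical_sets cardinality.

Set Implicit Arguments.
Unset Strict Implicit.
Unset Printing Implicit Defensive.

Import Order.TTheory GRing.Theory.

Local Open Scope order_scope.

(* The bounds 0 and 1 of a residuated lattice are written \bot and \top; they
   are not assumed to be distinct. *)
HB.mixin Record isResiduatedLattice d L of Order.TBLattice d L := {
  rmul : L -> L -> L;
  rimp : L -> L -> L;
  rmulA : associative rmul;
  rmulC : commutative rmul;
  rmul1 : left_id (\top : L) rmul;
  ler_rmul : forall x y z : L, x <= y -> rmul x z <= rmul y z;
  residuationP : forall x y z : L, (z <= rimp x y) = (rmul x z <= y)
}.

#[short(type="residuatedLatticeType")]
HB.structure Definition ResiduatedLattice d :=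
  { L of isResiduatedLattice d L & Order.TBLattice d L }.

Definition rneg d (L : residuatedLatticeType d) (x : L) : L := rimp x \bot.

Definition BL_algebra d (L : residuatedLatticeType d) : Prop :=
  (forall x y : L, rimp x y `|` rimp y x = \top) /\
  (forall x y : L, rmul x (rimp x y) = x `&` y).

Definition MV_algebra d (L : residuatedLatticeType d) : Prop :=
  BL_algebra L /\ forall x : L, rneg (rneg x) = x.

Record residuated_isomorphism d (L : residuatedLatticeType d)
    d' (L' : residuatedLatticeType d') (f : L -> L') : Prop := {
  riso_bij : bijective f;
  riso_meet : forall x y, f (x `&` y) = f x `&` f y;
  riso_join : forall x y, f (x `|` y) = f x `|` f y;
  riso_mul : forall x y, f (rmul x y) = rmul (f x) (f y);
  riso_imp : forall x y, f (rimp x y) = rimp (f x) (f y);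
  riso_bot : f \bot = \bot;
  riso_top : f \top = \top
}.

Definition residuated_isomorphic d (L : residuatedLatticeType d)
    d' (L' : residuatedLatticeType d') : Prop :=
  exists f : L -> L', residuated_isomorphism f.

Local Open Scope ring_scope.
Local Open Scope classical_set_scope.

(* idealr_closed of ring_quotient only describes proper ideals, whereas the
   whole ring is the top element of the lattice of ideals. *)
Definition is_ideal (R : comPzRingType) (A : set R) : Prop :=
  [/\ A 0, forall x y, A x -> A y -> A (x + y) & forall a x, A x -> A (a * x)].

Record ideal (R : comPzRingType) := Ideal {
  ideal_set :> R -> Prop;
  ideal_setP : is_ideal ideal_set
}.

HB.instance Definition _ (R : comPzRingType) := gen_eqMixin (ideal R).
HB.instance Definition _ (R : comPzRingType) := gen_choiceMixin (ideal R).

Lemma ideal_ext (R : comPzRingType) (I J : ideal R) :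
  (forall x, I x <-> J x) -> I = J.
Proof.
case: I J => [A hA] [B hB] /= AB.
have E : A = B by apply/seteqP; split=> x /AB.
by case: _ / E in hB *; congr Ideal; apply: Prop_irrelevance.
Qed.

Definition ideal_le (R : comPzRingType) (I J : ideal R) : bool :=
  `[< I `<=` J >].

Lemma ideal_le_refl (R : comPzRingType) : reflexive (@ideal_le R).
Proof. by move=> I; apply/asboolP. Qed.

Lemma ideal_le_anti (R : comPzRingType) : antisymmetric (@ideal_le R).
Proof.
by move=> I J /andP[/asboolP IJ /asboolP JI]; apply: ideal_ext => x; split=> [/IJ|/JI].
Qed.

Lemma ideal_le_trans (R : comPzRingType) : transitive (@ideal_le R).
Proof.
by move=> J I K /asboolP IJ /asboolP JK; apply/asboolP => x /IJ /JK.
Qed.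

Fact ideal_display : Order.disp_t. Proof. exact: Order.Disp tt tt. Qed.

HB.instance Definition _ (R : comPzRingType) :=
  Order.Le_isPOrder.Build ideal_display (ideal R)
    (@ideal_le_refl R) (@ideal_le_anti R) (@ideal_le_trans R).

Lemma ideal0_subproof (R : comPzRingType) : is_ideal [set (0 : R)].
Proof.
split=> //= [x y -> ->|a x ->]; first by rewrite addr0.
by rewrite mulr0.
Qed.
Definition ideal0 (R : comPzRingType) : ideal R := Ideal (ideal0_subproof R).

Lemma idealT_subproof (R : comPzRingType) : is_ideal [set: R].
Proof. by []. Qed.
Definition idealT (R : comPzRingType) : ideal R := Ideal (idealT_subproof R).

Lemma idealI_subproof (R : comPzRingType) (I J : ideal R) : is_ideal (I `&` J).
Proof.
case: I J => [A [A0 AD AM]] [B [B0 BD BM]] /=; split=> //.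
- by move=> x y [Ax Bx] [Ay By]; split; [apply: AD|apply: BD].
- by move=> a x [Ax Bx]; split; [apply: AM|apply: BM].
Qed.
Definition idealI (R : comPzRingType) (I J : ideal R) : ideal R :=
  Ideal (idealI_subproof I J).

Lemma idealD_subproof (R : comPzRingType) (I J : ideal R) :
  is_ideal [set z : R | exists x y, [/\ I x, J y & z = x + y]].
Proof.
case: I J => [A [A0 AD AM]] [B [B0 BD BM]] /=; split.
- by exists 0, 0; rewrite addr0.
- move=> _ _ [x [y [Ax By ->]]] [x' [y' [Ax' By' ->]]].
  by exists (x + x'), (y + y'); rewrite addrACA; split; [apply: AD|apply: BD|].
- move=> a _ [x [y [Ax By ->]]].
  by exists (a * x), (a * y); rewrite mulrDr; split; [apply: AM|apply: BM|].
Qed.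
Definition idealD (R : comPzRingType) (I J : ideal R) : ideal R :=
  Ideal (idealD_subproof I J).

Lemma idealM_subproof (R : comPzRingType) (I J : ideal R) :
  is_ideal [set z : R | exists s : seq (R * R),
    (forall p, p \in s -> I p.1 /\ J p.2) /\ z = \sum_(p <- s) p.1 * p.2].
Proof.
case: I J => [A [A0 AD AM]] [B [B0 BD BM]] /=; split.
- by exists [::]; rewrite big_nil.
- move=> _ _ [s [hs ->]] [t [ht ->]]; exists (s ++ t); rewrite big_cat; split=> //.
  by move=> p; rewrite mem_cat => /orP[/hs|/ht].
- move=> a _ [s [hs ->]]; exists [seq (a * p.1, p.2) | p <- s]; split.
    by move=> _ /mapP[p /hs[Ap Bp] ->] /=; split=> //; apply: AM.
  by rewrite big_map mulr_sumr; apply: eq_bigr => p _; rewrite mulrA.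
Qed.
Definition idealM (R : comPzRingType) (I J : ideal R) : ideal R :=
  Ideal (idealM_subproof I J).

Lemma ideal_colon_subproof (R : comPzRingType) (I J : ideal R) :
  is_ideal [set x : R | forall i, I i -> J (x * i)].
Proof.
case: I J => [A [A0 AD AM]] [B [B0 BD BM]] /=; split.
- by move=> i _; rewrite mul0r.
- by move=> x y hx hy i Ai; rewrite mulrDl; apply: BD; [apply: hx|apply: hy].
- by move=> a x hx i Ai; rewrite -mulrA; apply/BM/hx.
Qed.
(* [ideal_colon I J] is the ideal (J : I). *)
Definition ideal_colon (R : comPzRingType) (I J : ideal R) : ideal R :=
  Ideal (ideal_colon_subproof I J).

Lemma ideal_meetP (R : comPzRingType) (I J K : ideal R) :
  (I <= idealI J K)%O = (I <= J)%O && (I <= K)%O.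
Proof.
apply/asboolP/andP => [h|[/asboolP h /asboolP k] x Ix].
  by split; apply/asboolP => x /h[].
by split; [apply: h|apply: k].
Qed.

Lemma ideal_joinP (R : comPzRingType) (I J K : ideal R) :
  (idealD I J <= K)%O = (I <= K)%O && (J <= K)%O.
Proof.
case: (ideal_setP I) (ideal_setP J) (ideal_setP K) => I0 _ _ [J0 _ _] [_ KD _].
apply/asboolP/andP => [h|[/asboolP h /asboolP k] _ [x [y [Ix Jy ->]]]].
  split; apply/asboolP => x hx; apply: h.
    by exists x, 0; rewrite addr0.
  by exists 0, x; rewrite add0r.
by apply: KD; [apply: h|apply: k].
Qed.

HB.instance Definition _ (R : comPzRingType) :=
  Order.POrder_MeetJoin_isLattice.Build ideal_display (ideal R)
    (@ideal_meetP R) (@ideal_joinP R).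

Lemma ideal_le0 (R : comPzRingType) (I : ideal R) : (ideal0 R <= I)%O.
Proof. by apply/asboolP => _ ->; case: (ideal_setP I). Qed.

Lemma ideal_leT (R : comPzRingType) (I : ideal R) : (I <= idealT R)%O.
Proof. by apply/asboolP. Qed.

HB.instance Definition _ (R : comPzRingType) :=
  Order.hasBottom.Build ideal_display (ideal R) (@ideal_le0 R).
HB.instance Definition _ (R : comPzRingType) :=
  Order.hasTop.Build ideal_display (ideal R) (@ideal_leT R).

Lemma idealM_leP (R : comPzRingType) (I J K : ideal R) :
  (forall x y, I x -> J y -> K (x * y)) <-> (idealM I J <= K)%O.
Proof.
case: (ideal_setP K) => K0 KD _; split=> [h|/asboolP h x y Ix Jy].
  apply/asboolP => _ [s [hs ->]]; rewrite big_seq.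
  by elim/big_ind: _ => // p /hs[Ip Jp]; apply: h.
apply: h; exists [:: (x, y)]; rewrite big_seq1; split=> // p.
by rewrite inE => /eqP ->.
Qed.

Lemma idealM_mem (R : comPzRingType) (I J : ideal R) (x y : R) :
  I x -> J y -> idealM I J (x * y).
Proof. by move=> Ix Jy; apply: (idealM_leP I J (idealM I J)).2. Qed.

Lemma idealMC (R : comPzRingType) : commutative (@idealM R).
Proof.
move=> I J; apply: le_anti; apply/andP; split; apply/idealM_leP => x y Ix Jy;
by rewrite mulrC; apply: idealM_mem.
Qed.

Lemma ideal_residuationP (R : comPzRingType) (I J K : ideal R) :
  (K <= ideal_colon I J)%O = (idealM I K <= J)%O.
Proof.
apply/asboolP/idP => [h|/idealM_leP h x Kx i Ii].
  by apply/idealM_leP => x y Ix Ky; rewrite mulrC; apply: h.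
by rewrite mulrC; apply: h.
Qed.

Lemma idealM_mono (R : comPzRingType) (I J K : ideal R) :
  (I <= J)%O -> (idealM I K <= idealM J K)%O.
Proof.
move=> /asboolP IJ; apply/idealM_leP => x y /IJ Jx Ky; exact: idealM_mem.
Qed.

Lemma idealM_leA (R : comPzRingType) (I J K : ideal R) :
  (idealM (idealM I J) K <= idealM I (idealM J K))%O.
Proof.
rewrite idealMC -ideal_residuationP; apply/idealM_leP => x y Ix Jy z Kz.
by rewrite -mulrA; do 2?apply: idealM_mem.
Qed.

Lemma idealMA (R : comPzRingType) : associative (@idealM R).
Proof.
move=> I J K; apply: le_anti; apply/andP; split; last exact: idealM_leA.
rewrite idealMC (idealMC J) (idealMC _ K) (idealMC I).
exact: idealM_leA.
Qed.

Lemma idealM1 (R : comPzRingType) : left_id (\top : ideal R)%O (@idealM R).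
Proof.
move=> I; apply: le_anti; apply/andP; split.
  by apply/idealM_leP => a x _; case: (ideal_setP I) => _ _; apply.
by apply/asboolP => x Ix; rewrite -[x]mul1r; apply: idealM_mem.
Qed.

HB.instance Definition _ (R : comPzRingType) :=
  isResiduatedLattice.Build ideal_display (ideal R)
    (@idealMA R) (@idealMC R) (@idealM1 R) (@idealM_mono R)
    (@ideal_residuationP R).

(* Main.v *)
Require Import Defs.
From mathcomp Require Import all_boot all_order all_algebra.
From mathcomp Require Import boolp classical_sets cardinality.

(** Suppose that [L] is a finite BL-algebra isomorphic to the lattice of ideals
of a commutative ring [R].  For [x] in [L] put [y = x** -> x].  Divisibility
alone forces [y* = 0] ([rneg_double_neg_imp]): [y] is dense.  In [R] the ideal
corresponding to [y] thus has zero annihilator, and in a ring with finitely many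
ideals the only such ideal is [R] itself ([dense_ideal_top]).  Hence [y = 1],
that is [x** <= x], so that [L] is an MV-algebra.

The ring-theoretic fact is the place where rings differ from BL-algebras at
large: the three-element Goedel chain has a dense element other than [1].  For
an ideal [Y] with zero annihilator, choose [u] in [1 + Y] whose annihilator is
maximal.  If [u] were nonzero, the ideal [uR] would contain a minimal nonzero
ideal [urR].  Since [Y] does not annihilate [ur], minimality gives
[urY = urR], so [ur(1 - t) = 0] for some [t] in [Y]; then [u(1 - t)] lies in
[1 + Y], and its annihilator contains that of [u] and also [r], which does not
annihilate [u].  So [u = 0], that is, [1] lies in [Y]. *)

Set Implicit Arguments.
Unset Strict Implicit.
Unset Printing Implicit Defensive.

Import Order.TTheory GRing.Theory.
Local Open Scope order_scope.
Local Open Scope classical_set_scope.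

Lemma finite_ex_minimal d (T : porderType d) (P : T -> Prop) :
    finite_set [set: T] -> (exists x, P x) ->
  exists2 m, P m & forall x, P x -> x <= m -> x = m.
Proof.
move=> /finite_seqP[s sT] [x0 Px0].
have mem_s x : x \in s by have : [set: T] x by []; rewrite sT.
(* The size of the down-set of an element is strictly monotone. *)
pose down x := count (<= x) s.
have exP : exists n, `[< exists2 x, P x & down x = n >].
  by exists (down x0); apply/asboolP; exists x0.
case: (ex_minnP exP) => _ /asboolP[m Pm <-] m_min.
exists m => // x Px le_xm; apply/eqP/contraT => neq_xm.
have /m_min : `[< exists2 z, P z & down z = down x >] by apply/asboolP; exists x.
have -> : (down m <= down x)%N = false; last by [].
apply/negbTE; rewrite -ltnNge /down.
pose gap z := (z <= m) && ~~ (z <= x).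
have -> : count (<= m) s = (count (<= x)%O s + count gap s)%N.
  rewrite -(count_predUI (<= x)) [X in (_ + X)%N](@eq_count _ _ pred0) => [|z /=].
    rewrite count_pred0 addn0; apply: eq_count => z /=.
    rewrite /gap; case: (boolP (z <= x)) => [/le_trans/(_ le_xm) -> //|_].
    by rewrite /= andbT.
  by rewrite /gap; case: (z <= x); rewrite ?andbF.
rewrite -addn1 leq_add2l -has_count; apply/hasP; exists m => //.
by rewrite /gap lexx; apply: contra neq_xm => le_mx; rewrite eq_le le_xm.
Qed.

Lemma finite_ex_maximal d (T : porderType d) (P : T -> Prop) :
    finite_set [set: T] -> (exists x, P x) ->
  exists2 m, P m & forall x, P x -> m <= x -> x = m.
Proof. exact: (@finite_ex_minimal _ T^d). Qed.

Section ResiduatedLattices.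
Context d (L : residuatedLatticeType d).
Implicit Types x y z : L.

Lemma rmul_rneg_le x y : rmul x (rneg x) <= y.
Proof. by apply: (le_trans (y := \bot)); rewrite ?le0x // -residuationP. Qed.

Lemma rmul_imp_le x y : rmul x (rimp x y) <= y.
Proof. by rewrite -residuationP. Qed.

Lemma le_double_rneg x : x <= rneg (rneg x).
Proof. by rewrite residuationP rmulC rmul_rneg_le. Qed.

Lemma rneg_anti x y : x <= y -> rneg y <= rneg x.
Proof.
move=> le_xy; rewrite residuationP.
exact: le_trans (ler_rmul _ _ _ le_xy) (rmul_rneg_le _ _).
Qed.

Lemma rimp_top_le x y : rimp x y = \top -> x <= y.
Proof. by move=> xy1; have := rmul_imp_le x y; rewrite xy1 rmulC rmul1. Qed.

(** With [y = x** -> x], divisibility gives [x = x** y], from which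
[x* = y -> x*] and hence [x* = y x*]: multiplication by [y] fixes [x*], and so
fixes everything below it.  As [y* <= x*], it follows that [y* = y y* = 0]. *)
Lemma rneg_double_neg_imp x :
    (forall x y : L, rmul x (rimp x y) = (x `&` y)%O) ->
  rneg (rimp (rneg (rneg x)) x) = \bot.
Proof.
move=> divL; set a := rneg (rneg x); set y := rimp a x.
have a_neg : rmul a (rneg x) <= \bot by rewrite rmulC rmul_rneg_le.
have le_nx_y : rneg x <= y by rewrite residuationP (le_trans a_neg) ?le0x.
have le_xy : x <= y.
  by rewrite residuationP -[leRHS]rmul1 ler_rmul ?lex1.
have x_ay : x = rmul a y by rewrite divL (meet_r (le_double_rneg x)).
have le_y_imp : rimp y (rneg x) <= rneg x.
  rewrite {2}/rneg residuationP {1}x_ay -rmulA rmulC.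
  by apply: le_trans (ler_rmul _ _ _ (rmul_imp_le _ _)) _; rewrite rmulC.
have le_nx_ynx : rneg x <= rmul y (rneg x).
  rewrite -[leLHS](meet_r le_nx_y) -divL rmulC [leRHS]rmulC.
  exact: ler_rmul.
apply/eqP; rewrite -lex0 -[leLHS](meet_r (rneg_anti le_xy)) -divL.
apply: le_trans (ler_rmul _ _ _ le_nx_ynx) _.
by rewrite -rmulA divL (meet_r (rneg_anti le_xy)) rmul_rneg_le.
Qed.

End ResiduatedLattices.

Section Ideals.
Local Open Scope ring_scope.
Variable R : comPzRingType.
Implicit Types (u x y t : R) (Y : ideal R).

Lemma principal_is_ideal u : is_ideal [set z : R | exists r, z = u * r].
Proof.
split; first by exists 0; rewrite mulr0.
- by move=> _ _ [r ->] [s ->]; exists (r + s); rewrite mulrDr.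
- by move=> a _ [r ->]; exists (a * r); rewrite mulrCA.
Qed.
Definition principal u : ideal R := Ideal (principal_is_ideal u).

Lemma annihilator_is_ideal u : is_ideal [set z : R | u * z = 0].
Proof.
split=> [|x y /= ux uy|a x /= ux]; first exact: mulr0.
- by rewrite mulrDr ux uy addr0.
- by rewrite mulrCA ux mulr0.
Qed.
Definition annihilator u : ideal R := Ideal (annihilator_is_ideal u).

Hypothesis finR : finite_set [set: ideal R].

(** Take [urR] minimal among the nonzero principal ideals inside [uR]: it is
simple, so it is generated by any of its nonzero elements. *)
Lemma ex_minimal_multiple u : u != 0 ->
  exists r, u * r != 0 /\ forall s, u * r * s != 0 -> exists q, u * r = u * r * s * q.
Proof.
move=> u0; have [|_ [r ur0 ->] m_min] :=
    @finite_ex_minimal _ (ideal R)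
      (fun I => exists2 r, u * r != 0 & I = principal (u * r)) finR.
  by exists (principal (u * 1)); exists 1; rewrite // mulr1.
exists r; split=> // s urs0.
have le_s : (principal (u * r * s) <= principal (u * r))%O.
  by apply/asboolP => _ [q ->]; exists (s * q); rewrite !mulrA.
have E : principal (u * r * s) = principal (u * r).
  by apply: m_min le_s; exists (r * s); rewrite mulrA.
have : principal (u * r) (u * r) by exists 1; rewrite mulr1.
by rewrite -E.
Qed.

(** As [rneg Y] is the annihilator of [Y], the hypothesis says that [Y] acts
faithfully on [R].  An element [u] of [1 + Y] with maximal annihilator must then
vanish: otherwise some factor [1 - t * q] in [1 + Y] kills a nonzero multiple of
[u] and so enlarges that annihilator. *)
Lemma dense_ideal_top Y : rneg Y = \bot%O -> Y = \top%O.
Proof.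
move=> annY; have [_ YD YM] := ideal_setP Y.
have faithful x : x != 0 -> exists2 t, Y t & x * t != 0.
  move=> x0; apply: contrapT => noY; move/eqP: x0; apply.
  suff : rneg Y x by rewrite annY.
  by move=> t Yt /=; apply/eqP/contraT => xt0; case: noY; exists t.
have [|_ [u Yu ->] u_max] :=
    @finite_ex_maximal _ (ideal R)
      (fun I => exists2 u, Y (1 - u) & I = annihilator u) finR.
  exists (annihilator 1); exists 1; rewrite // subrr.
  by case: (ideal_setP Y).
have [u0|/ex_minimal_multiple[r [ur0 simple]]] := eqVneq u 0.
  apply/le_anti/andP; split; rewrite ?lex1 //; apply/asboolP => x _.
  by rewrite -[x]mulr1 -[1]subr0 -u0; apply: YM.
have [t Yt urt0] := faithful _ ur0; have [q urE] := simple _ urt0.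
(* [t * q] lies in [Y] and acts as the identity on [u * r]. *)
pose v := u * (1 - t * q).
have Yv : Y (1 - v).
  have -> : 1 - v = (1 - u) + u * q * t.
    by rewrite /v mulrBr mulr1 opprB addrCA addrC -mulrA (mulrC q).
  by apply: YD => //; apply: YM.
have le_uv : (annihilator u <= annihilator v)%O.
  by apply/asboolP => z /= uz; rewrite /v mulrAC uz mul0r.
have E : annihilator v = annihilator u by apply: u_max => //; exists v.
have : annihilator v r.
  by rewrite /= /v mulrAC mulrBr mulr1 mulrA -urE subrr.
by rewrite E /= => ur; rewrite ur eqxx in ur0.
Qed.

End Ideals.

Theorem theorem41 (d : Order.disp_t) (L : residuatedLatticeType d)
    (finL : finite_set [set: L]) (BL_L : BL_algebra L) (nMV_L : ~ MV_algebra L) :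
  ~ exists R : comPzRingType, residuated_isomorphic (ideal R) L.
Proof.
move=> [R [f [[g fK gK] _ _ _ f_imp f_bot f_top]]]; apply: nMV_L; split=> // x.
have finR : finite_set [set: ideal R].
  have -> : [set: ideal R] = g @` [set: L].
    by apply/seteqP; split=> // I _; exists (f I).
  exact: finite_image.
apply: le_anti; rewrite le_double_rneg andbT; apply: rimp_top_le.
set y := rimp _ _; have y_dense : rneg y = \bot by apply: rneg_double_neg_imp BL_L.2.
suff gy_top : g y = \top by rewrite -f_top -gy_top gK.
apply: (dense_ideal_top finR); apply: (can_inj fK).
by rewrite /rneg f_imp gK f_bot.
Qed.
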